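(* There exist absolute constants $c,c_1,c_2,c_3,c_4>0$ such that for every $M_0\in\mathbb{Z}^+$ there is an integer $M\ge 2$ with $c_1M_0\le M\le c_2M_0$ satisfying the following: for every (possibly randomized) allocator for Memory Reallocation with $M$ memory slots (where the total size of live objects may be as large as $M$), there is an update sequence, fixed in advance, in which all object sizes lie in $[c_3M/\log M,\ c_4M/\log M]$ and total live size never exceeds $M$, such that some update has expected switching cost at least $cM$.
   Context: Memory Reallocation: memory of $M$ slots indexed $0,\dots,M-1$; a dynamic set $X$ of live objects with sizes $\mu(x)\in\mathbb{Z}^+$; an allocation is $\phi\colon X\to\{0,\dots,M-1\}$ with $\phi(x)+\mu(x)\le M$ and pairwise disjoint intervals $[\phi(x),\phi(x)+\mu(x))$. Starting from $X=\varnothing$, updates (insert a new object of given size / delete a live object) arrive online; after each the allocator outputs an allocation of the new set $X'$, possibly moving existing objects. The (unnormalized) switching cost of an update inserting/deleting $x$ that changes $\phi$ to $\phi'$ is $\mu(x)+\sum_{y\in X\cap X',\ \phi(y)\ne\phi'(y)}\mu(y)$. Expectations are over the allocator's randomness (oblivious adversary). Logarithms base $2$. *)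

(* Defs.v *)
From HB Require Import structures.
From mathcomp Require Import all_boot all_order all_algebra finmap.
From mathcomp Require Import all_classical all_reals all_analysis.

Set Implicit Arguments.
Unset Strict Implicit.
Unset Printing Implicit Defensive.

Import Order.TTheory GRing.Theory Num.Theory.
Local Open Scope fset_scope.
Local Open Scope nat_scope.

(* An object is a pair (name, size), so that its size is revealed when it is
   inserted, and there are infinitely many objects of each size. *)
Notation object := (nat * nat)%type.
Definition mu (x : object) : nat := x.2.

Inductive update := Insert of object | Delete of object.

Definition updated (u : update) : object :=
  match u with Insert x => x | Delete x => x end.

Definition step (X : {fset object}) (u : update) : {fset object} :=
  match u with Insert x => x |` X | Delete x => X `\ x end.

Definition live (h : seq update) : {fset object} := foldl step fset0 h.

Definition inserted (h : seq update) : seq object :=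
  pmap (fun u => if u is Insert x then Some x else None) h.

Definition load (X : {fset object}) : nat := \sum_(x <- X) mu x.

(* Inserted objects are new: they are never reused after a deletion. *)
Inductive legal (M : nat) : seq update -> Prop :=
| legal_nil : legal M [::]
| legal_insert h x :
    legal M h -> x \notin inserted h -> 0 < mu x ->
    load (live (rcons h (Insert x))) <= M ->
    legal M (rcons h (Insert x))
| legal_delete h x :
    legal M h -> x \in live h -> legal M (rcons h (Delete x)).

(* phi is only meaningful on X; its values outside X are irrelevant. *)
Definition is_allocation (M : nat) (X : {fset object}) (phi : object -> nat) :
    Prop :=
  (forall x, x \in X -> phi x < M /\ phi x + mu x <= M) /\
  (forall x y, x \in X -> y \in X -> x != y ->
     phi x + mu x <= phi y \/ phi y + mu y <= phi x).

(* A randomized allocator, with random seed in T. Being online, the allocation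
   output after an update depends only on the seed and on the updates received
   so far. It must handle every legal history, up to total live size M. *)
Record allocator (M : nat) (d : measure_display) (T : measurableType d) := {
  alloc :> T -> seq update -> object -> nat;
  alloc_valid : forall w h, legal M h -> is_allocation M (live h) (alloc w h);
  alloc_measurable : forall h x, legal M h -> x \in live h ->
    measurable_fun [set: T] (fun w => alloc w h x)
}.

Definition switching_cost (X : {fset object}) (u : update)
    (phi phi' : object -> nat) : nat :=
  mu (updated u) +
  \sum_(y <- X `&` step X u | phi y != phi' y) mu y.

Definition expected_cost (R : realType) (M : nat) (d : measure_display)
    (T : measurableType d) (P : probability T R) (A : allocator M T)
    (h : seq update) (u : update) : \bar R :=
  ('E_P[fun w =>
     (switching_cost (live h) u (A w h) (A w (rcons h u)))%:R%R])%E.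

Definition log2 (R : realType) (x : R) : R := (ln x / ln 2)%R.

(* Main.v *)
Require Import Defs.
From HB Require Import structures.
From mathcomp Require Import all_boot all_order all_algebra finmap.
From mathcomp Require Import all_classical all_reals all_analysis.
From mathcomp Require Import measurable_realfun zify.

(** Take [n] objects of sizes [2^n + 2^i], [i < n], of total size exactly [M],
    so that every allocation of all of them is a tiling of the memory and the
    position of an object is the sum of the sizes to its left. All subset sums
    of these sizes are distinct. Now delete the objects [i] and [j] and insert
    one object of size [mu i + mu j]: the memory is full again. If another
    object [k] ends where it started, the sizes to its left have the same sum
    before and after, so distinctness of subset sums forces [i] and [j] to have
    been on the same side of [k]. Hence everything between [i] and [j] moves
    during the three updates. Among any three objects one lies between the other
    two, so for an average pair [(i, j)] a third of the memory is paid for,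
    whatever the random seed; averaging over the seed, the pair and the three
    updates gives one expensive update. *)

Set Implicit Arguments.
Unset Strict Implicit.
Unset Printing Implicit Defensive.

Import Order.TTheory GRing.Theory Num.Theory.
Local Open Scope ring_scope.

(** * Averaging over the random seed *)

Lemma measurable_natr (R : realType) (d : measure_display)
    (T : measurableType d) (f : T -> nat) :
  measurable_fun [set: T] f -> measurable_fun [set: T] (fun w => (f w)%:R : R).
Proof.
by move=> mf; apply: (measurableT_comp (f := fun n : nat => n%:R : R)).
Qed.

(** If all expectations over [Q] were below [b], their sum would be at most [b * #|I|], whereas
    integrating the pointwise bound gives at least [K]. *)
Lemma exists_expectation_ge (R : realType) (d : measure_display)
    (T : measurableType d) (P : probability T R) (I : finType) (Q : pred I)
    (F : I -> T -> nat) (b K : R) :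
  (forall e, Q e -> measurable_fun [set: T] (F e)) -> 0 <= b ->
  (forall w, K <= (\sum_(e | Q e) F e w)%N%:R) -> b * #|I|%:R < K ->
  exists2 e, Q e & (b%:E <= 'E_P[fun w => (F e w)%:R])%E.
Proof.
move=> mF b0 FK bK; apply: contrapT => none.
(* Extending by zero outside [Q] makes every term measurable; [0 <= b] keeps the bound on the
   integrals valid there. *)
pose f e w : R := if Q e then (F e w)%:R else 0.
have f0 e w : 0 <= f e w by rewrite /f; case: ifP.
have mf e : measurable_fun [set: T] (f e).
  rewrite /f; case Qe : (Q e); last exact: measurable_cst.
  by apply: measurable_natr; exact: mF.
have fb e : (\int[P]_w (f e w)%:E <= b%:E)%E.
  rewrite /f; case Qe : (Q e); last by rewrite integral0 lee_fin.
  have [|/ltW] := leP b%:E (\int[P]_w ((F e w)%:R : R)%:E)%E; last by [].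
  by move=> ge; exfalso; apply: none; exists e => //; rewrite unlock.
have sumE w : (\sum_(e <- index_enum I) (f e w)%:E =
    ((\sum_(e | Q e) F e w)%N%:R)%:E)%E.
  by rewrite sumEFin natr_sum [in RHS]big_mkcond.
have : (K%:E <= \sum_(e <- index_enum I) \int[P]_w (f e w)%:E)%E.
  rewrite -ge0_integral_sum//; last 2 first.
  - by move=> e; apply/measurable_EFinP; exact: mf.
  - by move=> e w _; rewrite lee_fin.
  have K0 : 0 <= K by apply: le_trans (ltW bK); rewrite mulr_ge0.
  rewrite -(expectation_cst P K) unlock.
  apply: ge0_le_integral => //.
  - by apply/measurable_EFinP; exact: measurable_cst.
  - by apply: emeasurable_sum => e; apply/measurable_EFinP; exact: mf.
  - by move=> w _; rewrite sumE lee_fin.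
apply/negP; rewrite -ltNge.
apply: (@le_lt_trans _ _ (\sum_(e <- index_enum I) b%:E)%E).
  by apply: lee_sum => e _; exact: fb.
by rewrite sumEFin lte_fin sumr_const -mulr_natr.
Qed.

Lemma measurable_fun_sumn (d : measure_display) (T : measurableType d)
    (I : Type) (s : seq I) (F : I -> T -> nat) :
  (forall i, measurable_fun [set: T] (F i)) ->
  measurable_fun [set: T] (fun w => \sum_(i <- s) F i w)%N.
Proof.
move=> mF; elim: s => [|i s IH].
  by under eq_fun do rewrite big_nil; exact: measurable_cst.
by under eq_fun do rewrite big_cons; exact: measurable_fun_addn.
Qed.

Lemma legal_rcons (M : nat) (h : seq update) (u : update) :
  legal M (rcons h u) -> legal M h.
Proof.
move E : (rcons h u) => g lg; case: lg E => [|h' x lh _ _ _|h' x lh _].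
- by case: h.
- by move/rcons_inj => [->].
- by move/rcons_inj => [->].
Qed.

Lemma measurable_switching_cost (M : nat) (d : measure_display)
    (T : measurableType d) (A : allocator M T) (h : seq update) (u : update) :
  legal M (rcons h u) ->
  measurable_fun [set: T]
    (fun w => switching_cost (live h) u (A w h) (A w (rcons h u))).
Proof.
move=> lhu; have lh := legal_rcons lhu.
apply: measurable_fun_addn; first exact: measurable_cst.
(* Positions are known to be measurable for live objects only, so membership is kept as a condition,
   with constant term 0 where it fails. *)
under eq_fun do rewrite big_mkcond big_seq_cond big_mkcond /=.
apply: measurable_fun_sumn => y.
case Ey : (y \in _) => /=; last exact: measurable_cst.
move: Ey; rewrite in_fsetI => /andP[y1 y2].
apply: measurable_fun_ifT => //.
apply: measurable_neg; apply: measurable_fun_eqn; apply: alloc_measurable => //.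
by rewrite /live foldl_rcons.
Qed.

Local Open Scope fset_scope.
Local Open Scope nat_scope.

(** * Tilings and distinct subset sums *)

(** By counting slots: concatenating the occupied intervals gives a duplicate-free list of slots,
    all of them in [[a, b)]. *)
Lemma sum_size_packing (phi : object -> nat) (s : seq object) (a b : nat) :
  uniq s ->
  (forall x, x \in s -> a <= phi x /\ phi x + mu x <= b) ->
  (forall x y, x \in s -> y \in s -> x != y ->
     phi x + mu x <= phi y \/ phi y + mu y <= phi x) ->
  \sum_(x <- s) mu x <= b - a.
Proof.
move=> us sab dis.
pose t := flatten [seq iota (phi x) (mu x) | x <- s].
have <- : size t = \sum_(x <- s) mu x.
  rewrite /t size_flatten /shape -map_comp sumnE big_map.
  by apply: eq_bigr => x _ /=; rewrite size_iota.
rewrite -[X in _ <= X](size_iota a); apply: uniq_leq_size; last first.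
  move=> k /flatten_mapP [x xs]; rewrite !mem_iota => /andP[].
  by have [] := sab x xs; lia.
rewrite {}/t; elim: s us sab dis => //= x s IH /andP[xs us] sab dis.
rewrite cat_uniq iota_uniq /= IH //; last 2 first.
- by move=> y ys; apply: sab; rewrite inE ys orbT.
- by move=> y z ys zs; apply: dis; rewrite inE ?ys ?zs orbT.
rewrite andbT; apply/hasPn => k /flatten_mapP[y ys].
rewrite !mem_iota => /andP[y1 y2]; apply/negP => /andP[x1 x2].
have yx : x != y by apply: contraNneq xs => ->.
have ysx : y \in x :: s by rewrite inE ys orbT.
by case: (dis x y (mem_head _ _) ysx yx); lia.
Qed.

(** The objects left of [y] fit into [[0, phi y)] and the remaining ones into [[phi y, M)]. Together
    they fill [M] slots, so both bounds are tight. *)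
Lemma tiling_position (M : nat) (X : {fset object}) (phi : object -> nat)
    (y : object) :
  is_allocation M X phi -> load X = M -> y \in X ->
  phi y = \sum_(x <- X | phi x < phi y) mu x.
Proof.
move=> [ran dis] full yX.
have left_le : \sum_(x <- X | phi x < phi y) mu x <= phi y - 0.
  rewrite -big_filter; apply: (@sum_size_packing phi).
  - exact: filter_uniq (fset_uniq _).
  - move=> x; rewrite mem_filter => /andP[lt xX]; split => //.
    have xy : x != y by apply: contraTneq lt => ->; rewrite ltnn.
    by case: (dis x y xX yX xy); lia.
  - by move=> x z; rewrite !mem_filter => /andP[_ xX] /andP[_ zX]; exact: dis.
have right_le : \sum_(x <- X | ~~ (phi x < phi y)) mu x <= M - phi y.
  rewrite -big_filter; apply: (@sum_size_packing phi).
  - exact: filter_uniq (fset_uniq _).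
  - move=> x; rewrite mem_filter => /andP[lt xX]; have [_] := ran _ xX.
    by lia.
  - by move=> x z; rewrite !mem_filter => /andP[_ xX] /andP[_ zX]; exact: dis.
have [_ yM] := ran _ yX.
have fullE : \sum_(x <- X | phi x < phi y) mu x +
    \sum_(x <- X | ~~ (phi x < phi y)) mu x = M.
  by rewrite -full /load [RHS](bigID (fun x => phi x < phi y)).
move: left_le right_le fullE.
by move: (\sum_(x <- X | _ < _) _) (\sum_(x <- X | ~~ _) _) => l r; lia.
Qed.

Lemma sum_pow2_lt (n : nat) (P : pred nat) : \sum_(i < n | P i) 2 ^ i < 2 ^ n.
Proof.
elim: n => [|n IH]; first by rewrite big_ord0.
rewrite big_mkcond big_ord_recr /= -big_mkcond expnS.
move: (\sum_(i < n | _) _) IH => t.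
by case: (P n); lia.
Qed.

Lemma sum_pow2_inj (n : nat) (P Q : pred nat) :
  \sum_(i < n | P i) 2 ^ i = \sum_(i < n | Q i) 2 ^ i ->
  forall i, i < n -> P i = Q i.
Proof.
elim: n => // n IH.
rewrite [LHS]big_mkcond [RHS]big_mkcond !big_ord_recr -!big_mkcond /= => e.
have lP := sum_pow2_lt n P; have lQ := sum_pow2_lt n Q.
(* The lower bits sum to less than [2 ^ n] on both sides, so the top bits agree. *)
have ePQ : P n = Q n.
  move: e lP lQ; move: (\sum_(i < n | P i) _) (\sum_(i < n | Q i) _) => p q.
  by case: (P n); case: (Q n) => //; lia.
move=> i; rewrite ltnS leq_eqVlt => /orP[/eqP -> //|]; apply: IH.
by move: e; rewrite ePQ => /addIn.
Qed.

(** Modulo [2 ^ n] the common summands vanish and the rest, being below [2 ^ n], is left intact;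
    binary expansions are unique. *)
Lemma subset_sum_inj (n : nat) (P Q : pred nat) :
  \sum_(i < n | P i) (2 ^ n + 2 ^ i) = \sum_(i < n | Q i) (2 ^ n + 2 ^ i) ->
  forall i, i < n -> P i = Q i.
Proof.
move=> e; apply: sum_pow2_inj; move: e; rewrite !big_split /=.
rewrite !sum_nat_const => /(congr1 (modn^~ (2 ^ n))).
by rewrite !modnMDl !modn_small ?sum_pow2_lt.
Qed.

(** The endpoints count, so that in any triple, even with repetitions, some index lies between the
    other two. *)
Definition between (T : Type) (f : T -> nat) (i j k : T) : bool :=
  (f i <= f k <= f j) || (f j <= f k <= f i).

(** Each of the [n ^ 3] ordered triples is counted at least once by the sum [S] over all triples or
    by its two cyclic relabellings [S1] and [S2]. Injectivity keeps the diagonal contribution down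
    to [n]. *)
Lemma sum_between_ge (n : nat) (f : 'I_n -> nat) : injective f ->
  n ^ 3 <= 3 * (\sum_i \sum_(j | i != j) \sum_k between f i j k) + 3 * n.
Proof.
move=> finj.
pose S := \sum_i \sum_j \sum_k (between f i j k : nat).
have S1 : S = \sum_i \sum_j \sum_k (between f j k i : nat).
  by rewrite [RHS]exchange_big; apply: eq_bigr => j _; rewrite exchange_big.
have S2 : S = \sum_i \sum_j \sum_k (between f k i j : nat).
  by rewrite /S exchange_big; apply: eq_bigr => i _; rewrite exchange_big.
have S3 : n ^ 3 <= S + S + S.
  rewrite {2}S1 {2}S2 /S -!big_split /=.
  have -> : n ^ 3 = \sum_(i < n) \sum_(j < n) \sum_(k < n) 1.
    by rewrite !sum_nat_const card_ord muln1.
  apply: leq_sum => i _; rewrite -!big_split /=.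
  apply: leq_sum => j _; rewrite -!big_split /=.
  by apply: leq_sum => k _; rewrite /between; lia.
(* The diagonal [i = j] contributes only the terms [k = i]. *)
have SE : S = \sum_i \sum_(j | i != j) \sum_k between f i j k + n.
  rewrite -[X in _ = _ + X]card_ord -[X in _ = _ + X]sum1_card -big_split /=.
  apply: eq_bigr => i _; rewrite (bigD1 i) //= addnC; congr (_ + _).
    by apply: eq_bigl => j; rewrite eq_sym.
  rewrite (bigD1 i) //= /between !leqnn /= big1 ?addn0 // => k ki.
  by have := contra_neq (@finj k i) ki; lia.
by move: SE S3; move: (\sum_i \sum_(j | _) _) => t -> ; lia.
Qed.

(** * The hard update sequences *)

Lemma inserted_map_Insert (s : seq object) :
  inserted [seq Insert x | x <- s] = s.
Proof. by elim: s => //= x s; rewrite /inserted /= => ->. Qed.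

Lemma live_map_Insert (s : seq object) : live [seq Insert x | x <- s] =i s.
Proof.
elim/last_ind: s => [|s x IH] y; first by rewrite inE.
by rewrite map_rcons /live foldl_rcons /= !inE IH mem_rcons inE.
Qed.

Lemma sum_fset_eq (X : {fset object}) (s : seq object) (P : pred object)
    (F : object -> nat) :
  uniq s -> X =i s -> \sum_(x <- X | P x) F x = \sum_(x <- s | P x) F x.
Proof. by move=> us Xs; apply/perm_big/uniq_perm => //; exact: fset_uniq. Qed.

Lemma legal_map_Insert (M : nat) (s : seq object) :
  uniq s -> {in s, forall x, 0 < mu x} -> \sum_(x <- s) mu x <= M ->
  legal M [seq Insert x | x <- s].
Proof.
elim/last_ind: s => [|s x IH]; first by constructor.
move=> uxs s0 sM; move: (uxs); rewrite rcons_uniq => /andP[xs us].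
rewrite map_rcons; constructor.
- apply: IH => // [y ys|]; first by apply: s0; rewrite mem_rcons inE ys orbT.
  by apply: leq_trans sM; rewrite big_rcons /=; exact: leq_addr.
- by rewrite inserted_map_Insert.
- by apply: s0; rewrite mem_rcons mem_head.
- by rewrite /load -map_rcons (sum_fset_eq _ _ uxs (live_map_Insert _)).
Qed.

Lemma sum_pow2S (n : nat) : (\sum_(i < n) 2 ^ i).+1 = 2 ^ n.
Proof.
elim: n => [|n IH]; first by rewrite big_ord0.
by rewrite big_ord_recr /= -addSn IH expnS mul2n addnn.
Qed.

Section Instance.
Variable n : nat.
Implicit Types i j k l : 'I_n.

(** The summand [2 ^ n] keeps all sizes within a factor 2 of each other; [2 ^ i] tells the subset
    sums apart. *)
Definition obj (i : nat) : object := (i, 2 ^ n + 2 ^ i).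
Definition memory : nat := \sum_(i < n) (2 ^ n + 2 ^ i).
Definition objects : seq object := [seq obj (val i) | i <- enum 'I_n].
Definition fill : seq update := [seq Insert x | x <- objects].
(** The name [n] is fresh, since the initial objects have names below [n]. *)
Definition merged i j : object := (n, mu (obj i) + mu (obj j)).
Lemma memoryE : memory.+1 = n.+1 * 2 ^ n.
Proof.
rewrite /memory big_split /= sum_nat_const card_ord mulSn.
by rewrite -addnS sum_pow2S addnC.
Qed.

Lemma obj_inj : injective obj.
Proof. by move=> i j []. Qed.

Lemma objects_uniq : uniq objects.
Proof.
by rewrite map_inj_uniq ?enum_uniq // => i j /obj_inj /val_inj.
Qed.

Lemma mem_objects i : obj i \in objects.
Proof. by apply: map_f; rewrite mem_enum. Qed.

Lemma merged_notin i j : merged i j \notin objects.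
Proof.
by apply/mapP => -[k _ [kn _]]; have := ltn_ord k; rewrite -kn ltnn.
Qed.

Lemma sum_objects (P : pred object) (F : object -> nat) :
  \sum_(x <- objects | P x) F x = \sum_(i < n | P (obj i)) F (obj i).
Proof. by rewrite big_map big_enum_cond. Qed.

Lemma legal_fill : legal memory fill.
Proof.
apply: legal_map_Insert; first exact: objects_uniq.
- by move=> _ /mapP[i _ ->] /=; rewrite /mu /=; lia.
- by rewrite sum_objects.
Qed.

Lemma live_fill : live fill =i objects.
Proof. exact: live_map_Insert. Qed.

Section Exchange.
Variables (i j : 'I_n).
Hypothesis ij : i != j.

Definition others : seq object :=
  [seq obj (val k) | k <- enum 'I_n & (k != i) && (k != j)].

Lemma mem_others k : (obj k \in others) = (k != i) && (k != j).
Proof.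
by rewrite (mem_map (inj_comp obj_inj val_inj)) mem_filter mem_enum andbT.
Qed.

Lemma others_uniq : uniq others.
Proof.
rewrite map_inj_uniq; first exact/filter_uniq/enum_uniq.
exact: inj_comp obj_inj val_inj.
Qed.

Lemma others_objects x :
  (x \in others) = [&& x \in objects, x != obj i & x != obj j].
Proof.
apply/mapP/and3P.
  move=> [k]; rewrite mem_filter => /andP[/andP[ki kj] _ ->]; split.
  - exact: mem_objects.
  - by apply: contra_neq ki => /obj_inj /val_inj.
  - by apply: contra_neq kj => /obj_inj /val_inj.
move=> [/mapP[k _ ->] ki kj]; exists k => //; rewrite mem_filter mem_enum andbT.
by apply/andP; split; [apply: contra_neq ki|apply: contra_neq kj] => ->.
Qed.

Lemma merged_notin_others : merged i j \notin others.
Proof. by rewrite others_objects (negbTE (merged_notin _ _)). Qed.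

(** The merged object is split back into [i] and [j], which share its fate. Sums after the exchange
    thus become subset sums of the original sizes, comparable with those before it. *)
Lemma sum_merged_others (P : pred object) :
  \sum_(x <- merged i j :: others | P x) mu x =
  \sum_(k < n | if (k == i) || (k == j) then P (merged i j) else P (obj k))
     mu (obj k).
Proof.
rewrite big_cons big_map big_filter_cond big_enum_cond /=.
rewrite [RHS](bigID (fun k => (k == i) || (k == j))) /=.
rewrite [X in _ = _ + X](eq_bigl
    (fun k : 'I_n => (k != i) && (k != j) && P (obj k))); last first.
  by move=> k; case: (k == i); case: (k == j); rewrite /= ?andbT ?andbF.
rewrite [X in _ = X + _](eq_bigl
    (fun k : 'I_n => ((k == i) || (k == j)) && P (merged i j))); last first.
  by move=> k; case: (k == i); case: (k == j); rewrite /= ?andbT ?andbF.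
case: (P _); last by rewrite [X in _ = X + _]big1 // => k; rewrite andbF.
rewrite [X in _ = X + _](bigD1 i) ?eqxx //=.
rewrite [X in _ = _ + X + _](bigD1 j) /=; last first.
  by rewrite (eq_sym j i) (negbTE ij) eqxx.
rewrite [X in _ = _ + (_ + X) + _]big1 ?addn0 // => k.
by case: (k == i); case: (k == j).
Qed.

Definition hist1 := rcons fill (Delete (obj i)).
Definition hist2 := rcons hist1 (Delete (obj j)).
Definition hist3 := rcons hist2 (Insert (merged i j)).

Lemma live_hist1 x : (x \in live hist1) = (x != obj i) && (x \in objects).
Proof. by rewrite /live foldl_rcons /= !inE live_fill. Qed.

Lemma live_hist2 : live hist2 =i others.
Proof.
move=> x; rewrite /live foldl_rcons /= in_fsetD1 live_hist1 others_objects.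
by case: (x != _); case: (x != _); rewrite ?andbF ?andbT.
Qed.

Lemma live_hist3 : live hist3 =i merged i j :: others.
Proof. by move=> x; rewrite /live foldl_rcons /= in_fset1U live_hist2. Qed.

Lemma load_hist3 : load (live hist3) = memory.
Proof.
rewrite /load (sum_fset_eq _ _ _ live_hist3) /=; last first.
  by rewrite merged_notin_others others_uniq.
by rewrite sum_merged_others; apply: eq_bigl => k; case: ifP.
Qed.

Lemma inserted_hist3 : inserted hist3 = rcons objects (merged i j).
Proof.
rewrite /inserted /hist3 /hist2 /hist1 -!cats1 !pmap_cat /= !cats0.
by rewrite -/(inserted fill) inserted_map_Insert.
Qed.

Lemma legal_hist3 : legal memory hist3.
Proof.
have l1 : legal memory hist1.
  by constructor; [exact: legal_fill|rewrite live_fill mem_objects].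
have l2 : legal memory hist2.
  constructor => //; rewrite live_hist1 mem_objects andbT.
  by apply: contra_neq ij => /obj_inj /val_inj.
constructor => //.
- rewrite /inserted /hist2 /hist1 -!cats1 !pmap_cat /= !cats0.
  by rewrite -/(inserted fill) inserted_map_Insert merged_notin.
- by rewrite /mu /=; lia.
- by rewrite load_hist3.
Qed.

Lemma between_moved (phi phi' : object -> nat) k :
  is_allocation memory (live fill) phi ->
  is_allocation memory (live hist3) phi' ->
  k != i -> k != j -> between (fun l => phi (obj l)) i j k ->
  phi (obj k) != phi' (obj k).
Proof.
move=> al al' ki kj bt; apply/eqP => stay.
have load0 : load (live fill) = memory.
  by rewrite /load (sum_fset_eq _ _ objects_uniq live_fill) sum_objects.
have kfill : obj k \in live fill by rewrite live_fill mem_objects.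
have kh3 : obj k \in live hist3.
  by rewrite live_hist3 inE mem_others ki kj orbT.
(* Without ties, an object not to the left of [k] is strictly to its right, so [i] and [j] on the
   same side contradicts [bt]. *)
have dist l : l != k -> phi (obj l) != phi (obj k).
  move=> lk; have lfill : obj l \in live fill by rewrite live_fill mem_objects.
  have olk : obj l != obj k by apply: contra_neq lk => /obj_inj /val_inj.
  by have := al.2 _ _ lfill kfill olk; rewrite /mu /=; lia.
have pos := tiling_position al load0 kfill.
have pos' := tiling_position al' load_hist3 kh3.
rewrite (sum_fset_eq _ _ objects_uniq live_fill) sum_objects in pos.
rewrite (sum_fset_eq _ _ _ live_hist3) /= ?merged_notin_others ?others_uniq //
  sum_merged_others in pos'.
have := @subset_sum_inj n (fun m => phi (obj m) < phi (obj k))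
  (fun m => if (m == i :> nat) || (m == j :> nat)
            then phi' (merged i j) < phi' (obj k)
            else phi' (obj m) < phi' (obj k)).
move=> /(_ _) inj; have e := inj (etrans (esym pos) (etrans stay pos')).
have ei := e i (ltn_ord i); have ej := e j (ltn_ord j).
rewrite !eqxx /= in ei; rewrite eqxx orbT in ej.
move: bt; rewrite /between; have := dist i; have := dist j.
rewrite ![_ == k]eq_sym ki kj => /(_ isT) ? /(_ isT) ?.
move: ei; rewrite -ej; lia.
Qed.

(** An object whose position differs between [phi0] and [phi3] moved in at least one of the three
    updates, and its size, at least [2 ^ n], is paid there. The intermediate allocations can be
    arbitrary. *)
Lemma exchange_cost (phi0 phi1 phi2 phi3 : object -> nat) :
  is_allocation memory (live fill) phi0 ->
  is_allocation memory (live hist3) phi3 ->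
  2 ^ n * (\sum_k between (fun l => phi0 (obj l)) i j k) <=
  switching_cost (live fill) (Delete (obj i)) phi0 phi1 +
  switching_cost (live hist1) (Delete (obj j)) phi1 phi2 +
  switching_cost (live hist2) (Insert (merged i j)) phi2 phi3.
Proof.
move=> al0 al3; rewrite /switching_cost /=.
have sub1 : {subset others <= live fill `&` (live fill `\ obj i)}.
  by move=> x; rewrite others_objects !inE live_fill => /and3P[-> -> _].
have sub2 : {subset others <= live hist1 `&` (live hist1 `\ obj j)}.
  by move=> x; rewrite others_objects !inE live_hist1 => /and3P[-> -> ->].
have sub3 : {subset others <= live hist2 `&` (merged i j |` live hist2)}.
  by move=> x xo; rewrite !inE live_hist2 xo orbT.
have big_sub (X : {fset object}) (P : pred object) : {subset others <= X} ->
    \sum_(x <- others | P x) mu x <= \sum_(x <- X | P x) mu x.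
  move=> oX.
  rewrite (@sum_fset_eq X (others ++ [seq x <- X | x \notin others])).
  - by rewrite big_cat /= leq_addr.
  - rewrite cat_uniq others_uniq filter_uniq ?fset_uniq // andbT.
    by apply/hasPn => x; rewrite mem_filter => /andP[].
  - move=> x; rewrite mem_cat mem_filter.
    by case: (boolP (x \in others)) => // /oX ->.
have c1 := big_sub _ (fun y => phi0 y != phi1 y) sub1.
have c2 := big_sub _ (fun y => phi1 y != phi2 y) sub2.
have c3 := big_sub _ (fun y => phi2 y != phi3 y) sub3.
have c : \sum_(x <- others | phi0 x != phi3 x) mu x <=
    \sum_(x <- others | phi0 x != phi1 x) mu x +
    \sum_(x <- others | phi1 x != phi2 x) mu x +
    \sum_(x <- others | phi2 x != phi3 x) mu x.
  rewrite !(big_mkcond (fun x => _ x != _ x)) -!big_split /=.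
  apply: leq_sum => x _.
  case: (phi0 x =P phi1 x) => [->|_] /=.
    case: (phi1 x =P phi2 x) => [->|_] /=; first by rewrite !add0n.
    by rewrite add0n; case: ifP => // _; rewrite leq_addr.
  by case: ifP => // _; rewrite -addnA leq_addr.
(* The endpoints [k = i] and [k = j] are paid for by the two deletions. *)
have main : 2 ^ n * (\sum_k between (fun l => phi0 (obj l)) i j k) <=
    mu (obj i) + mu (obj j) + \sum_(x <- others | phi0 x != phi3 x) mu x.
  rewrite /others big_map big_filter_cond big_enum_cond big_mkcondr /=.
  rewrite big_distrr /= (bigD1 i) //= (bigD1 j) /=; last by rewrite eq_sym.
  rewrite addnA; apply: leq_add.
    by apply: leq_add; case: between; rewrite /mu /=; lia.
  rewrite -big_mkcond big_mkcondr; apply: leq_sum => k /andP[ki kj].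
  case: (boolP (between _ _ _ _)) => bt; last by rewrite muln0.
  by rewrite (between_moved al0 al3 ki kj bt) muln1 leq_addr.
apply: leq_trans main _.
(* The cost of the inserted object itself is discarded. *)
apply: leq_trans (leq_add (leqnn _) (leq_trans c
  (leq_add (leq_add c1 c2) (leq_trans c3 (leq_addl (mu (merged i j)) _))))) _.
by rewrite addnA leq_add2r addnACA.
Qed.

End Exchange.
End Instance.

(** * Averaging over the pairs and the three updates *)

Definition stage (n : nat) (i j : 'I_n) (t : nat) : seq update * update :=
  match t with
  | 0 => (fill n, Delete (obj n i))
  | 1 => (hist1 i, Delete (obj n j))
  | _ => (hist2 i j, Insert (merged i j))
  end.

(** Every stage is a prefix of one sequence, so it inherits legality, and whichever update is costly
    occurs in [hist3]. *)
Lemma stage_hist3 (n : nat) (i j : 'I_n) (t : nat) :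
  exists r, hist3 i j = rcons (stage i j t).1 (stage i j t).2 ++ r.
Proof.
case: t => [|[|t]] /=.
- exists [:: Delete (obj n j); Insert (merged i j)].
  by rewrite -!cat_rcons cats0.
- by exists [:: Insert (merged i j)]; rewrite cats1.
- by exists [::]; rewrite cats0.
Qed.

Lemma legal_catl (M : nat) (h r : seq update) : legal M (h ++ r) -> legal M h.
Proof.
elim/last_ind: r => [|r u IH]; first by rewrite cats0.
by rewrite -rcons_cat => /legal_rcons.
Qed.

Lemma legal_stage (n : nat) (i j : 'I_n) (t : nat) : i != j ->
  legal (memory n) (rcons (stage i j t).1 (stage i j t).2).
Proof.
move=> ij; have [r e] := stage_hist3 i j t.
by apply: (@legal_catl _ _ r); rewrite -e; exact: legal_hist3.
Qed.

Definition stage_cost (n : nat) (d : measure_display) (T : measurableType d)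
    (A : allocator (memory n) T) (i j : 'I_n) (t : nat) (w : T) : nat :=
  let hu := stage i j t in
  switching_cost (live hu.1) hu.2 (A w hu.1) (A w (rcons hu.1 hu.2)).

(** For a fixed seed the allocation after [fill] is the same for all pairs, because the allocator is
    online. One injective position function therefore serves all the exchanges, and [sum_between_ge]
    applies to it. *)
Lemma sum_stage_cost (n : nat) (d : measure_display) (T : measurableType d)
    (A : allocator (memory n) T) (w : T) :
  2 ^ n * n ^ 3 <= 3 * (\sum_(e : 'I_n * 'I_n * 'I_3 | e.1.1 != e.1.2)
      stage_cost A e.1.1 e.1.2 e.2 w) + 3 * n * 2 ^ n.
Proof.
have -> : \sum_(e : 'I_n * 'I_n * 'I_3 | e.1.1 != e.1.2)
      stage_cost A e.1.1 e.1.2 e.2 w =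
    \sum_i \sum_(j | i != j) \sum_(t < 3) stage_cost A i j t w.
  by rewrite pair_big_dep pair_big_dep /=; apply: eq_bigl => e; rewrite andbT.
have al0 : is_allocation (memory n) (live (fill n)) (A w (fill n)).
  by apply: alloc_valid; exact: legal_fill.
have finj : injective (fun i : 'I_n => A w (fill n) (obj n i)).
  move=> i j eij; apply/eqP/contraT => ij.
  have : obj n i != obj n j by apply: contra_neq ij => /obj_inj /val_inj.
  move/(al0.2 _ _ _ _); rewrite !live_fill !mem_objects => /(_ isT isT).
  by rewrite /= in eij; rewrite eij /mu /=; lia.
have := leq_mul (leqnn (2 ^ n)) (sum_between_ge finj).
move/leq_trans; apply; rewrite mulnDr; apply: leq_add; last first.
  by rewrite mulnC.
rewrite mulnCA leq_mul2l /= big_distrr /=; apply: leq_sum => i _.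
rewrite big_distrr /=; apply: leq_sum => j ij.
rewrite !big_ord_recl big_ord0 addn0 addnA /=.
apply: exchange_cost => //; apply: alloc_valid; exact: legal_hist3.
Qed.

Lemma costly_stage (R : realType) (n : nat) (d : measure_display)
    (T : measurableType d) (P : probability T R)
    (A : allocator (memory n) T) : 3 <= n ->
  exists (i j : 'I_n) (t : 'I_3), i != j /\
    ((19^-1 * (memory n)%:R)%:E <=
       expected_cost P A (stage i j t).1 (stage i j t).2)%E.
Proof.
move=> n3.
(* The threshold is [sum_stage_cost] solved for the total cost; the index type has [3 * n ^ 2]
   elements, diagonal included. *)
have [||w||[[i j] t] /= ij ge] := @exists_expectation_ge R d T P
    ('I_n * 'I_n * 'I_3)%type (fun e => e.1.1 != e.1.2)
    (fun e => stage_cost A e.1.1 e.1.2 e.2) (19^-1 * (memory n)%:R)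
    (3^-1 * (2 ^ n * (n ^ 3 - 3 * n))%:R)%R; last by exists i, j, t.
- by move=> e ne; apply: measurable_switching_cost; exact: legal_stage.
- by rewrite mulr_ge0 // invr_ge0.
- have := sum_stage_cost A w.
  move: (\sum_(e | _) _) => S H.
  rewrite mulrC ler_pdivrMr // -natrM ler_nat.
  by rewrite mulnBr leq_subLR addnC [S * 3]mulnC [2 ^ n * (3 * n)]mulnC.
- rewrite !card_prod !card_ord.
  rewrite -mulrA -natrM mulrC [ltRHS]mulrC ltr_pdivrMr // mulrAC.
  rewrite ltr_pdivlMr // -!natrM ltr_nat.
  have := memoryE n; have : 0 < 2 ^ n by rewrite expn_gt0.
  move: (2 ^ n) (memory n) => p m p0 mE.
  (* At [n = 3] this reads 324 < 342; with 18 in place of 19 it would be an equality. *)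
  have key : 9 * (n * n) * n.+1 < 19 * (n ^ 3 - 3 * n).
    have -> : n ^ 3 = n * n * n by rewrite !expnS expn0 muln1 mulnA.
    by nia.
  apply: (@leq_ltn_trans (p * (9 * (n * n) * n.+1))); first by nia.
  by rewrite -[ltnRHS]mulnA ltn_pmul2l // [_ * 19]mulnC.
Qed.

(** * The lower bound *)

(** Passing from [n] to [n.+1] multiplies [(memory n).+1] by less than 3, so [n] is increased only
    when [m] outgrows [memory n]. *)
Lemma memory_geometric (m : nat) : 0 < m ->
  exists n, [/\ 3 <= n, m <= memory n & memory n <= 31 * m].
Proof.
elim: m => // -[_ _|m /(_ isT) [n [n3 mn nm]] _].
  (* The factor 31 is [memory 3], needed for [m = 1]. *)
  by exists 3; have := memoryE 3; rewrite -[4 * 2 ^ 3]/32; split; lia.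
have [lt|ge] := ltnP m.+1 (memory n).
  by exists n; split => //; lia.
exists n.+1; have := memoryE n; have := memoryE n.+1.
rewrite expnS; have : 0 < 2 ^ n by rewrite expn_gt0.
by split; nia.
Qed.

(** Logarithms of [2 ^ n <= memory n <= 2 ^ (2 * n)], the upper bound coming from [n < 2 ^ n]. *)
Lemma log2_memory (R : realType) (n : nat) : 0 < n ->
  (n%:R <= log2 (memory n)%:R :> R)%R /\
  (log2 (memory n)%:R <= (2 * n)%:R :> R)%R.
Proof.
move=> n0; have ME := memoryE n.
have p0 : 0 < 2 ^ n by rewrite expn_gt0.
have np : n < 2 ^ n by rewrite ltn_expl.
have M1 : 2 ^ n <= memory n by nia.
have M2 : memory n <= 2 ^ (2 * n) by rewrite mul2n -addnn expnD; nia.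
have ln20 : (0 < ln 2 :> R)%R by rewrite ln_gt0 // ltr1n.
have M0 : (0 < (memory n)%:R :> R)%R by rewrite ltr0n; lia.
have lnp k : (k%:R * ln 2 = ln (2 ^ k)%:R :> R)%R.
  by rewrite natrX lnXn // mulr_natl.
rewrite /log2 ler_pdivlMr // ler_pdivrMr // !lnp.
by split; rewrite ler_ln ?posrE ?ler_nat // ltr0n // expn_gt0.
Qed.

Local Close Scope nat_scope.
Local Close Scope fset_scope.

Theorem theorem5p1 (R : realType) :
  exists c c1 c2 c3 c4 : R,
    [/\ 0 < c, 0 < c1, 0 < c2, 0 < c3 & 0 < c4] /\
    forall M0 : nat, (0 < M0)%N ->
    exists M : nat,
      [/\ (2 <= M)%N, c1 * M0%:R <= M%:R & M%:R <= c2 * M0%:R] /\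
      forall (d : measure_display) (T : measurableType d)
             (P : probability T R) (A : allocator M T),
      exists s : seq update,
        [/\ legal M s,
            (forall x : object, x \in inserted s ->
               c3 * M%:R / log2 M%:R <= (mu x)%:R /\
               (mu x)%:R <= c4 * M%:R / log2 M%:R) &
            exists (h : seq update) (u : update) (r : seq update),
              s = h ++ u :: r /\
              ((c * M%:R)%:E <= expected_cost P A h u)%E].
Proof.
(* The last two constants combine sizes in [[2 ^ n, 4 * 2 ^ n]], a logarithm in [[n, 2 * n]] and
   [n * 2 ^ n <= M <= 2 * n * 2 ^ n]. *)
exists 19^-1, 1, 31%:R, 2^-1, 8%:R; split; first by split; rewrite ?invr_gt0.
move=> M0 /memory_geometric[n [n3 Mlo Mhi]]; exists (memory n).
have ME := memoryE n; have p0 : (0 < 2 ^ n)%N by rewrite expn_gt0.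
split; first by rewrite mul1r -natrM !ler_nat; split => //; nia.
(* The pair depends on [P] and [A] but not on the seed, so the sequence is fixed in advance. *)
move=> d T P A; have [i [j [t [ij cost]]]] := costly_stage P A n3.
have [r e] := stage_hist3 i j t.
exists (hist3 i j); split; first exact: legal_hist3.
- move=> x xin.
  (* The factor 4 is for the merged object, made of two sizes of at most [2 * 2 ^ n]. *)
  have [xlo xhi] : (2 ^ n <= mu x)%N /\ (mu x <= 4 * 2 ^ n)%N.
    have sz (k : 'I_n) : (2 ^ k <= 2 ^ n)%N by rewrite leq_exp2l // ltnW.
    move: xin; rewrite inserted_hist3 mem_rcons inE => /orP[/eqP ->|].
      by have := sz i; have := sz j; rewrite /mu /=; lia.
    by move=> /mapP[k _ ->]; have := sz k; rewrite /mu /=; lia.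
  have n0 : (0 < n)%N by lia.
  have [llo lhi] := @log2_memory R n n0.
  have l0 : 0 < log2 (memory n)%:R :> R.
    by apply: lt_le_trans llo; rewrite ltr0n; lia.
  rewrite ler_pdivrMr // ler_pdivlMr //; split.
    apply: (@le_trans _ _ ((2 ^ n)%:R * n%:R)); last first.
      by apply: ler_pM => //; rewrite ler_nat.
    rewrite mulrC ler_pdivrMr // -!natrM ler_nat; nia.
  apply: (@le_trans _ _ ((4 * 2 ^ n)%:R * (2 * n)%:R)).
    by apply: ler_pM => //; rewrite ?ler_nat // ltW.
  by rewrite -!natrM ler_nat; nia.
- exists (stage i j t).1, (stage i j t).2, r; split => //.
  by rewrite e cat_rcons.
Qed.
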